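(* Let $S=K[x_1,\dots,x_n]$ be a polynomial ring over a field $K$, and let $I\subseteq S$ be a homogeneous square-free monomial ideal (generated by square-free monomials of one common degree) with no embedded associated primes. Let $m$ be the number of minimal associated primes of $I$. Then for $k\ge 1$, $$\mathrm{v}(I^{(k)})+1\ \le\ \mathrm{v}(I^{(k+1)})\ \le\ \mathrm{v}(I^{(k)})+m.$$
   Context: For a square-free monomial ideal $I$ with set of minimal associated primes $\mathrm{Min}(I)$, the $k$-th symbolic power is $I^{(k)}=\bigcap_{P\in\mathrm{Min}(I)}P^k$. The v-number: for a graded ideal $I$ of the standard graded polynomial ring $S$ with $\mathfrak m=(x_1,\dots,x_n)$, $\mathrm{v}(I)=\min\{d\ge 1 : \text{there exist } f\in S_d \text{ and } \mathfrak p\in \mathrm{Ass}(I) \text{ with } (I:f)=\mathfrak p\}$ if $I\subsetneq\mathfrak m$, and $\mathrm{v}(\mathfrak m)=0$. Here $S_d$ is the degree-$d$ component and $\mathrm{Ass}(I)$ is the set of associated primes of $S/I$.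
   Formalization: The ideal I is taken nonzero and proper, and the lower bound is asserted except when k = 1 and I is a prime ideal other than 𝔪, where it is false under the given definition (d ≥ 1): for I = (x_1) in K[x_1,x_2], v(I) = v(I^(2)) = 1. *)

(* Defs.v *)
From HB Require Import structures.
From mathcomp Require Import all_boot all_order all_algebra.
From mathcomp Require Import boolp classical_sets cardinality.
From mathcomp Require Import mpoly.

Set Implicit Arguments.
Unset Strict Implicit.
Unset Printing Implicit Defensive.

Import GRing.Theory.
Local Open Scope classical_set_scope.
Local Open Scope ring_scope.

Section Ideals.
Context {R : comNzRingType}.
Implicit Types (I J P A : set R) (f : R).

Definition is_ideal I : Prop :=
  [/\ I 0, forall a b, I a -> I b -> I (a + b)
    & forall a b, I b -> I (a * b)].

Definition ideal_gen A : set R := smallest is_ideal A.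

Definition is_prime_ideal P : Prop :=
  [/\ is_ideal P, ~ P 1 & forall a b, P (a * b) -> P a \/ P b].

Definition ideal_mul I J : set R :=
  ideal_gen [set h | exists a b, [/\ I a, J b & h = a * b]].

Definition ideal_exp I (k : nat) : set R := iter k (ideal_mul I) setT.

Definition colon I f : set R := [set g | I (g * f)].

(* The associated primes of the module R / I, that is, the prime ideals which
   are annihilators of a class f + I. *)
Definition Ass I : set (set R) :=
  [set P | is_prime_ideal P /\ exists f, colon I f = P].

Definition Min I : set (set R) :=
  [set P | Ass I P /\ forall Q, Ass I Q -> Q `<=` P -> Q = P].

Definition symbolic_power I (k : nat) : set R :=
  \bigcap_(P in Min I) ideal_exp P k.

End Ideals.

Section Monomial.
Context {K : fieldType} {n : nat}.
Implicit Types (I : set {mpoly K[n]}) (mm : 'X_{1..n}).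

Definition max_ideal : set {mpoly K[n]} :=
  ideal_gen [set f | exists i : 'I_n, f = 'X_i].

Definition squarefree_mnm mm : Prop := forall i, (mm i <= 1)%N.

Definition equigenerated_squarefree I : Prop :=
  exists (d : nat) (G : set 'X_{1..n}),
    (forall mm, G mm -> squarefree_mnm mm /\ mdeg mm = d) /\
    I = ideal_gen [set f | exists2 mm, G mm & f = 'X_[mm]].

Definition v_degrees I : set nat :=
  [set d | (1 <= d)%N /\
     exists (f : {mpoly K[n]}) (P : set {mpoly K[n]}),
       [/\ f \is d.-homog, Ass I P & colon I f = P]].

(* The set v_degrees I is nonempty for every graded ideal I strictly contained
   in max_ideal, so that the default value 0 is irrelevant there. *)
Definition v_number I : nat :=
  if `[< I = max_ideal >] then 0%N
  else xget 0%N [set d | v_degrees I d /\ forall e, v_degrees I e -> (d <= e)%N].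

End Monomial.

Arguments max_ideal : clear implicits.

(* Main.v *)
Require Import Defs.
From HB Require Import structures.
From mathcomp Require Import all_boot all_order all_algebra.
From mathcomp Require Import boolp classical_sets cardinality.
From mathcomp Require Import mpoly.

Set Implicit Arguments.
Unset Strict Implicit.
Unset Printing Implicit Defensive.

Local Open Scope classical_set_scope.
Local Open Scope ring_scope.

(** The theorem becomes a statement about monomials. Write P_E for the prime
    generated by the variables indexed by E and deg_E u for the degree of a
    monomial u in those variables; P_E ^ k consists of the polynomials all of
    whose monomials satisfy k <= deg_E u. A square-free monomial ideal I is the
    intersection of the P_E that contain it, so its minimal primes are the P_E
    with E in the antichain W of minimal such sets, and I^(k) is the intersection
    of the P_E ^ k for E in W.

    If (I^(k) : f) is prime, then by prime avoidance (interpow_colon_prime) it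
    contains some P_E with E in W and f outside P_E ^ k. As W is an antichain,
    some monomial u of f then has deg_E u = k - 1 and k <= deg_D u for every
    other D in W; conversely (I^(k) : u) = P_E for every such u. Hence v(I^(k)) is
    the least positive degree of such a monomial (v_degreesP), except that the
    v-number of the maximal ideal is 0 by convention.

    Both bounds follow by changing u. Dividing a monomial for k + 1 by a variable
    of E gives one for k, of degree one less (colon_witness_pred). Multiplying a
    monomial for k by one variable of E, and for every other D in W by one
    variable of D outside E, gives one for k + 1, of degree larger by #|W|, which
    is the number of minimal primes (colon_witness_succ). The monomial 1 is the
    only one of degree 0; it arises only for k = 1 and W = {E}, that is, for
    I = P_E, which accounts for the excluded case of the lower bound. *)

Import GRing.Theory.

(** * Ideals *)

Section IdealTheory.
Context {R : comNzRingType}.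
Implicit Types (A I P : set R).

Lemma is_ideal_gen A : is_ideal (ideal_gen A).
Proof.
split=> [J [[J0 _ _] _] //|a b Ia Ib J JA|a b Ib J JA].
  by have [_ JD _] := JA.1; apply: JD; [apply: Ia|apply: Ib].
by have [_ _ JM] := JA.1; apply: JM; apply: Ib.
Qed.

Lemma sub_ideal_gen A : A `<=` ideal_gen A.
Proof. exact: sub_gen_smallest. Qed.

Lemma ideal_gen_sub A I : is_ideal I -> A `<=` I -> ideal_gen A `<=` I.
Proof. exact: smallest_sub. Qed.

Lemma ideal_sum I (T : eqType) (r : seq T) (F : T -> R) :
  is_ideal I -> {in r, forall x, I (F x)} -> I (\sum_(x <- r) F x).
Proof.
move=> [I0 ID _] IF; rewrite big_seq.
by elim/big_rec: _ => // x s xr; apply: ID; apply: IF.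
Qed.

Lemma prime_prod P (T : finType) (D : {pred T}) (F : T -> R) :
  is_prime_ideal P -> {in D, forall x, ~ P (F x)} -> ~ P (\prod_(x in D) F x).
Proof.
move=> [_ P1 PM] PF; elim/big_ind: _ => [//|a b Pa Pb /PM []|x /PF] //.
Qed.

Lemma prime_exp P (a : R) (k : nat) : is_prime_ideal P -> ~ P a -> ~ P (a ^+ k).
Proof.
move=> [_ P1 PM] Pa; elim: k => [|k IH]; first by rewrite expr0.
by rewrite exprS => /PM [].
Qed.

End IdealTheory.

(** * Powers of monomial primes *)

Section MonomialPrimes.
Context {K : fieldType} {n : nat}.
Implicit Types (D E : {set 'I_n}) (u : 'X_{1..n}) (f g : {mpoly K[n]}).

Definition partdeg E u : nat := (\sum_(i in E) u i)%N.

Lemma partdegD E u v : partdeg E (u + v)%MM = (partdeg E u + partdeg E v)%N.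
Proof. by rewrite -big_split; apply: eq_bigr => i _; rewrite mnmDE. Qed.

Lemma partdeg1 E i : partdeg E U_(i)%MM = (i \in E).
Proof.
rewrite /partdeg; case: (boolP (i \in E)) => iE.
  rewrite (bigD1 i) //= mnm1E eqxx big1 // => j /andP[_ ji].
  by rewrite mnm1E eq_sym (negbTE ji).
by rewrite big1 // => j jE; rewrite mnm1E; case: eqP iE => // ->; rewrite jE.
Qed.

Lemma partdeg_sum E (T : Type) (r : seq T) (D : pred T) (F : T -> 'X_{1..n}) :
  partdeg E (\big[mnm_add/0%MM]_(x <- r | D x) F x)
    = (\sum_(x <- r | D x) partdeg E (F x))%N.
Proof.
apply: (big_morph (partdeg E)) => [u v|]; first exact: partdegD.
by rewrite /partdeg big1 // => i _; rewrite mnm0E.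
Qed.

Lemma partdeg_gt0 E u : (0 < partdeg E u)%N -> exists2 i, i \in E & (0 < u i)%N.
Proof.
rewrite lt0n sum_nat_eq0 => /forallPn[i]; rewrite negb_imply -lt0n.
by case/andP; exists i.
Qed.

Lemma mnm_divX u i : (0 < u i)%N -> u = (u - U_(i) + U_(i))%MM.
Proof.
move=> ui; rewrite submK //; apply/mnm_lepP => j; rewrite mnm1E.
by case: eqP => // <-.
Qed.

(** The k-th power of the prime generated by the variables in E; that it is this
    power is varpow_exp. Describing it by supports makes membership a condition
    on single monomials. *)
Definition varpow E (k : nat) : set {mpoly K[n]} :=
  [set f | {in msupp f, forall u, (k <= partdeg E u)%N}].

Lemma varpow_ideal E k : is_ideal (varpow E k).
Proof.
split=> [u|f g Hf Hg u|f g Hg u]; first by rewrite msupp0.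
  by move/msuppD_le; rewrite mem_cat => /orP[/Hf|/Hg].
case/msuppM_le/allpairsP => -[u1 u2] /= [_ /Hg le2 ->].
by rewrite partdegD (leq_trans le2) ?leq_addl.
Qed.

Lemma varpowX E k u : varpow E k 'X_[u] <-> (k <= partdeg E u)%N.
Proof.
split=> [|Eu v]; first by apply; rewrite msuppX inE.
by rewrite msuppX inE => /eqP ->.
Qed.

Lemma varpowM E j k f g :
  varpow E j f -> varpow E k g -> varpow E (j + k) (f * g).
Proof.
move=> Hf Hg u /msuppM_le/allpairsP[[u1 u2] /= [/Hf le1 /Hg le2 ->]].
by rewrite partdegD leq_add.
Qed.

Lemma varpow_exprn E k f : varpow E 1 f -> varpow E k (f ^+ k).
Proof.
by move=> Hf; elim: k => [|k IH] //; rewrite exprS -add1n; apply: varpowM.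
Qed.

Lemma varpowMX E k f u :
  varpow E k (f * 'X_[u]) <->
  {in msupp f, forall v, (k <= partdeg E u + partdeg E v)%N}.
Proof.
split=> Hf v; last first.
  by rewrite (perm_mem (msuppMX _ _)) => /mapP[w /Hf le ->]; rewrite partdegD.
move=> vf; rewrite -partdegD; apply: Hf; rewrite (perm_mem (msuppMX _ _)).
by apply/mapP; exists v.
Qed.

Lemma ideal_msupp (I : set {mpoly K[n]}) f :
  is_ideal I -> {in msupp f, forall u, I 'X_[u]} -> I f.
Proof.
move=> II If; rewrite [f]mpolyE; apply: ideal_sum => // u uf.
by rewrite -mul_mpolyC; have [_ _] := II; apply; apply: If.
Qed.

(** A monomial of E-degree at least k + 1 has a variable of E as a factor;
    splitting it off leaves a monomial of E-degree at least k. *)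
Lemma varpow_exp E k : ideal_exp (varpow E 1) k = varpow E k.
Proof.
elim: k => [|k IH]; first by apply/seteqP; split=> f // _.
rewrite /ideal_exp iterS -/(ideal_exp _ k) IH; apply/seteqP; split.
  apply: ideal_gen_sub => [|_ [f [g [Hf Hg ->]]]]; first exact: varpow_ideal.
  by rewrite -add1n; apply: varpowM.
move=> f Hf; apply: ideal_msupp => [|u /Hf ku]; first exact: is_ideal_gen.
have [i iE ui] := partdeg_gt0 (leq_ltn_trans (leq0n k) ku).
apply: sub_ideal_gen; exists 'X_i, 'X_[u - U_(i)]; split.
- by apply/varpowX; rewrite partdeg1 iE.
- apply/varpowX; move: ku.
  by rewrite {1}(mnm_divX ui) partdegD partdeg1 iE addn1 ltnS.
by rewrite -mpolyXD addmC -mnm_divX.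
Qed.

(** The endomorphism setting the variables of E to zero. Its kernel is varpow E 1,
    whence the latter is prime. *)
Definition kill E : {mpoly K[n]} -> {mpoly K[n]} :=
  comp_mpoly [tuple if i \in E then 0 else 'X_i | i < n].

Lemma killX E u : kill E 'X_[u] = if partdeg E u == 0%N then 'X_[u] else 0.
Proof.
rewrite /kill comp_mpolyX; case: ifPn => [|].
  rewrite sum_nat_eq0 => /forall_inP Eu.
  rewrite [RHS]mpolyXE_id; apply: eq_bigr => i _; rewrite tnth_mktuple.
  by case: ifP => // /Eu /eqP ->; rewrite !expr0.
rewrite -lt0n => /partdeg_gt0[i iE ui].
by rewrite (bigD1 i) //= tnth_mktuple iE expr0n gtn_eqF // mul0r.
Qed.

Lemma killP E f : kill E f = 0 <-> varpow E 1 f.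
Proof.
have killE : kill E f = \sum_(u <- msupp f) f@_u *: kill E 'X_[u].
  rewrite /kill {1}[f]mpolyE raddf_sum.
  by apply: eq_bigr => u _; rewrite -comp_mpolyZ.
split=> [kf0 u uf|Hf]; last first.
  rewrite killE big_seq big1 // => u /Hf; rewrite killX lt0n => /negbTE ->.
  by rewrite scaler0.
rewrite lt0n; apply/negP => Eu0; move: uf; rewrite mcoeff_msupp => /negP[].
rewrite -[0](mcoeff0 K u) -kf0 killE raddf_sum /=.
have [uf|/memN_msupp_eq0 fu0] := boolP (u \in msupp f); last first.
  rewrite fu0 big1_seq // => v /andP[_ vf]; rewrite mcoeffZ killX.
  case: ifP; rewrite ?mcoeff0 ?mulr0 // mcoeffX => _.
  by case: eqP vf => [->|]; rewrite ?mulr0 // mcoeff_msupp fu0 eqxx.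
rewrite (bigD1_seq u) ?msupp_uniq //= killX Eu0 mcoeffZ mcoeffX eqxx mulr1.
rewrite big1 ?addr0 // => v /negbTE vu; rewrite mcoeffZ killX.
by case: ifP; rewrite ?mcoeffX ?vu ?mcoeff0 mulr0.
Qed.

Lemma varpow_prime E : is_prime_ideal (varpow E 1).
Proof.
split; first exact: varpow_ideal.
  by move/killP/eqP; rewrite /kill comp_mpoly1 oner_eq0.
move=> f g /killP; rewrite /kill rmorphM => /eqP; rewrite mulf_eq0.
by case/orP => /eqP /killP; [left|right].
Qed.

Lemma varpow_sub E D : varpow E 1 `<=` varpow D 1 <-> E \subset D.
Proof.
split=> [sub|/fintype.subsetP sub f Hf].
  apply/fintype.subsetP => i iE; have: varpow D 1 'X_i.
    by apply: sub; apply/varpowX; rewrite partdeg1 iE.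
  by move/varpowX; rewrite partdeg1; case: (i \in D).
move=> u /Hf /partdeg_gt0[i iE ui]; rewrite /partdeg (bigD1 i) ?sub //=.
by rewrite ltn_addr.
Qed.

Lemma varpow_inj : injective (fun E => varpow E 1).
Proof.
move=> E D /seteqP[/varpow_sub ED /varpow_sub DE].
by apply/eqP; rewrite finset.eqEsubset ED.
Qed.

(** * Intersections of powers of monomial primes *)

Implicit Types (W : {set {set 'I_n}}).

Definition interpow W (k : nat) : set {mpoly K[n]} :=
  [set f | {in W, forall E, varpow E k f}].

(** Prime avoidance: if every component E with f outside varpow E k had an
    element g_E outside P, the product of the g_E ^+ k would multiply f into
    the intersection, hence lie in P. *)
Lemma interpow_colon_prime W k f P :
  is_prime_ideal P -> colon (interpow W k) f = P ->
  exists E, [/\ E \in W, ~ varpow E k f & varpow E 1 `<=` P].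
Proof.
move=> Pprime colP; apply: contrapT => noE.
pose D := [pred E in W | ~~ `[< varpow E k f >]].
have /choice[g gP] : forall E, exists g, E \in D -> varpow E 1 g /\ ~ P g.
  move=> E; apply: contrapT => nog; case: (noE); exists E.
  have [DE|nDE] := boolP (E \in D); last first.
    by case: nog; exists 0 => DE; rewrite DE in nDE.
  have /andP[EW /asboolPn Ef] := DE; split=> // g Eg; apply: contrapT => Pg.
  by case: nog; exists g.
have : ~ P (\prod_(E in D) g E ^+ k).
  by apply: prime_prod => // E /gP[_]; apply: prime_exp.
apply; rewrite -colP => E EW.
have [_ _ EM] := varpow_ideal E k.
have [DE|] := boolP (E \in D); last first.
  by rewrite inE /= EW negbK => /asboolP; apply: EM.
rewrite (bigD1 E) //= mulrC; apply: (EM); rewrite mulrC; apply: EM.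
by apply: varpow_exprn; have [] := gP E DE.
Qed.

(** Multiplying by u already brings everything into the components other than E,
    and leaves a deficit of exactly one in the E-degree. *)
Lemma interpow_colonX W k E u :
  E \in W -> (partdeg E u).+1 = k ->
  {in W, forall D, D != E -> (k <= partdeg D u)%N} ->
  colon (interpow W k) 'X_[u] = varpow E 1.
Proof.
move=> EW Eu Wu; apply/seteqP; split=> f /=.
  move=> /(_ E EW)/varpowMX Hf v /Hf.
  by rewrite -Eu -addn1 leq_add2l.
move=> Hf D DW; apply/varpowMX => v /Hf Ev.
have [->|/(Wu D DW) Du] := eqVneq D E; first by rewrite -Eu -addn1 leq_add2l.
by rewrite (leq_trans Du) ?leq_addr.
Qed.

(** The monomial u of degree d misses the k-th power of exactly one component E,
    and by one degree only, so that it realizes the associated prime varpow E 1 of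
    interpow W k. The degree d = 0 is admitted here, unlike in the v-number. *)
Definition colon_witness W (k d : nat) : Prop :=
  exists E u, [/\ E \in W, mdeg u = d, (partdeg E u).+1 = k
    & {in W, forall D, D != E -> (k <= partdeg D u)%N}].

Definition antichain W : Prop :=
  {in W &, forall E D, E \subset D -> E = D}.

Lemma antichainPn W E D : antichain W -> E \in W -> D \in W -> D != E ->
  exists2 i, i \in D & i \notin E.
Proof.
move=> antiW EW DW DE; apply/fintype.subsetPn; apply: contra DE => /antiW ->//.
Qed.

(** Given f with prime colon ideal P containing varpow E 1, multiply f by a variable
    i of E: the product lies in every component. For the component E this forces
    all monomials of f to have E-degree at least k - 1; for another component D,
    choosing i outside D forces D-degree at least k. *)
Lemma v_degreesP W k d : antichain W -> finset.set0 \notin W ->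
  v_degrees (interpow W k) d <-> (1 <= d)%N /\ colon_witness W k d.
Proof.
move=> antiW W0; split=> -[d1]; last first.
  case=> E [u [EW ud Eu Wu]]; split=> //.
  have colE := interpow_colonX EW Eu Wu.
  exists 'X_[u], (varpow E 1); split=> //; first by rewrite dhomogX -ud eqxx.
  by split; [apply: varpow_prime|exists 'X_[u]].
case=> f [P [fd [Pprime _] colP]]; split=> //.
have [E [EW Ef EP]] := interpow_colon_prime Pprime colP.
have Xf i D u : i \in E -> D \in W -> u \in msupp f ->
    (k <= (i \in D) + partdeg D u)%N.
  move=> iE DW uf; have /EP : varpow E 1 'X_i.
    by apply/varpowX; rewrite partdeg1 iE.
  by rewrite -colP => /(_ D DW); rewrite mulrC -partdeg1 => /varpowMX; apply.
have [u uf uk] : exists2 u, u \in msupp f & (partdeg E u < k)%N.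
  apply: contrapT => nou; case: Ef => u uf; rewrite leqNgt; apply/negP => uk.
  by case: nou; exists u.
exists E, u; split=> //; first by move/dhomogP: fd => /(_ u uf).
  have [i iE] : exists i, i \in E.
    by apply/finset.set0Pn; apply: contraNneq W0 => <-.
  have := Xf i E u iE EW uf; rewrite iE add1n => ku.
  by apply/eqP; rewrite eqn_leq uk.
move=> D DW; rewrite eq_sym => DE.
have [i iE iD] := antichainPn antiW DW EW DE.
by have := Xf i D u iE DW uf; rewrite (negbTE iD).
Qed.

(** * Minimal primes of a square-free monomial ideal *)

(** When I is the edge ideal of a hypergraph these are its vertex covers: the sets
    that meet every edge. *)
Definition vertex_covers (I : set {mpoly K[n]}) : {set {set 'I_n}} :=
  [set E | `[< I `<=` varpow E 1 >]].

Definition min_covers (I : set {mpoly K[n]}) : {set {set 'I_n}} :=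
  [set E | minset (mem (vertex_covers I)) E].

Lemma vertex_coversP I E : reflect (I `<=` varpow E 1) (E \in vertex_covers I).
Proof. by rewrite inE; apply: asboolP. Qed.

Lemma min_coversW I E : E \in min_covers I -> E \in vertex_covers I.
Proof. by rewrite inE => /minsetp. Qed.

Lemma min_covers_min I E D :
  E \in min_covers I -> D \in vertex_covers I -> D \subset E -> D = E.
Proof. by rewrite inE => Emin DI; apply: (minsetinf Emin). Qed.

Lemma min_covers_exists I D : D \in vertex_covers I ->
  exists2 E, E \in min_covers I & E \subset D.
Proof.
move=> DI; have [E minE ED] := minset_exists (DI : mem (vertex_covers I) D).
by exists E; rewrite ?inE.
Qed.

Lemma antichain_min_covers I : antichain (min_covers I).
Proof. by move=> E D /min_coversW EI DI; apply: min_covers_min DI EI. Qed.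

Lemma squarefree_interpow I :
  equigenerated_squarefree I -> I = interpow (vertex_covers I) 1.
Proof.
case=> d [G [Gsq Igen]]; apply/seteqP; split=> f Hf.
  by move=> E /vertex_coversP; apply.
have II : is_ideal I by rewrite Igen; apply: is_ideal_gen.
apply: ideal_msupp => // u uf.
(* The variables not dividing u form a set meeting every generator, unless some
   generator divides u. *)
have [w Gw wu] : exists2 w, G w & (w <= u)%MM.
  apply: contrapT => now.
  have /Hf/(_ u uf)/partdeg_gt0[i] : [set i | u i == 0%N]%SET \in vertex_covers I.
    apply/vertex_coversP; rewrite Igen; apply: ideal_gen_sub => [|_ [w Gw ->]].
      exact: varpow_ideal.
    apply/varpowX; rewrite lt0n; apply/negP; rewrite sum_nat_eq0.
    move=> /forall_inP w0; apply: now; exists w => //; apply/mnm_lepP => i.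
    have [ui0|] := eqVneq (u i) 0%N.
      by have /eqP -> : w i == 0%N by apply: w0; rewrite inE ui0.
    by rewrite -lt0n; apply: leq_trans; apply: (Gsq w Gw).1.
  by rewrite inE => /eqP ->.
rewrite -(submK wu) mpolyXD; have [_ _] := II; apply.
by rewrite Igen; apply: sub_ideal_gen; exists w.
Qed.

(** Some component is contained in P and does not contain f; conversely, if g * f
    lies in that component then g does, since the component is prime. *)
Lemma Ass_interpow W P : Ass (interpow W 1) P ->
  exists2 E, E \in W & P = varpow E 1.
Proof.
case=> Pprime [f colP]; have [E [EW Ef EP]] := interpow_colon_prime Pprime colP.
exists E => //; apply/seteqP; split=> // g; rewrite -colP => /(_ E EW).
by have [_ _ PM] := varpow_prime E; case/PM.
Qed.

(** The product of the variables outside E: the colon ideal of a square-free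
    monomial ideal by it is varpow E 1 when E is a minimal cover. *)
Definition mnmC E : 'X_{1..n} := [multinom (i \notin E : nat) | i < n].

Lemma partdeg_mnmC E : partdeg E (mnmC E) = 0%N.
Proof. by rewrite /partdeg big1 // => i iE; rewrite mnmE iE. Qed.

Lemma partdeg_mnmC_gt0 E D i :
  i \in D -> i \notin E -> (0 < partdeg D (mnmC E))%N.
Proof. by move=> iD iE; rewrite /partdeg (bigD1 i) //= mnmE iE. Qed.

Lemma min_cover_Ass I E : equigenerated_squarefree I -> E \in min_covers I ->
  Ass I (varpow E 1).
Proof.
move=> sqI minE; split; first exact: varpow_prime.
exists 'X_[mnmC E]; rewrite {1}(squarefree_interpow sqI).
apply: interpow_colonX => [||D DI DE].
- exact: min_coversW.
- by rewrite partdeg_mnmC.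
have /fintype.subsetPn[i iD iE] : ~~ (D \subset E).
  by apply: contra DE => /(min_covers_min minE DI) ->.
exact: partdeg_mnmC_gt0 iD iE.
Qed.

Lemma Min_squarefree I : equigenerated_squarefree I ->
  Min I = [set varpow E 1 | E in [set` min_covers I]].
Proof.
move=> sqI; apply/seteqP; split=> [P [assP minP]|_ [E minE <-]].
  have [D DI PD] : exists2 E, E \in vertex_covers I & P = varpow E 1.
    by apply: Ass_interpow; rewrite -squarefree_interpow.
  have [E minE ED] := min_covers_exists DI.
  exists E => //; apply: minP; first exact: min_cover_Ass.
  by rewrite PD; apply/varpow_sub.
split=> [|Q assQ]; first exact: min_cover_Ass.
have [D DI ->] : exists2 E, E \in vertex_covers I & Q = varpow E 1.
  by apply: Ass_interpow; rewrite -squarefree_interpow.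
by move/varpow_sub => /(min_covers_min minE DI) ->.
Qed.

Lemma symbolic_interpow I k : equigenerated_squarefree I ->
  symbolic_power I k = interpow (min_covers I) k.
Proof.
move=> sqI; rewrite /symbolic_power Min_squarefree // bigcap_image.
by apply/seteqP; split=> f Hf E /Hf; rewrite varpow_exp.
Qed.

Lemma squarefree_min_interpow I :
  equigenerated_squarefree I -> I = interpow (min_covers I) 1.
Proof.
move=> sqI; rewrite {1}(squarefree_interpow sqI); apply/seteqP; split=> f Hf E.
  by move/min_coversW; apply: Hf.
case/min_covers_exists => D minD /varpow_sub; apply; exact: Hf.
Qed.

Lemma card_min_covers I m : equigenerated_squarefree I ->
  (Min I #= `I_m)%card -> #|min_covers I| = m.
Proof.
move=> sqI; rewrite Min_squarefree //.
rewrite (card_eql (inj_card_eq _)); last by move=> E D _ _ /varpow_inj.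
have -> : [set` min_covers I] = enum_val @` [set: 'I_#|min_covers I|].
  apply/seteqP; split=> [E minE|_ [i _ <-]]; last exact: enum_valP.
  by exists (enum_rank_in minE E) => //; rewrite enum_rankK_in.
rewrite (card_eql (inj_card_eq _)); last by move=> i j _ _ /enum_val_inj.
by rewrite -(card_eql card_II) => /card_eq_II.
Qed.

End MonomialPrimes.

(** * Monomial witnesses for consecutive powers *)

Section Witnesses.
Context {n : nat}.
Implicit Types (D E : {set 'I_n}) (W : {set {set 'I_n}}) (u : 'X_{1..n}).

Lemma colon_witness1 W E : antichain W -> E \in W ->
  colon_witness W 1 (mdeg (mnmC E)).
Proof.
move=> antiW EW; exists E, (mnmC E); split=> //; first by rewrite partdeg_mnmC.
move=> D DW DE; have [i iD iE] := antichainPn antiW EW DW DE.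
exact: partdeg_mnmC_gt0 iD iE.
Qed.

(** Dividing by a variable of E lowers the degree in every component by at most
    one, and the E-degree by exactly one. *)
Lemma colon_witness_pred W k d : (1 <= k)%N -> colon_witness W k.+1 d ->
  exists2 d', d = d'.+1 & colon_witness W k d'.
Proof.
move=> k1 [E [u [EW ud [Eu] Wu]]].
have [i iE ui] : exists2 i, i \in E & (0 < u i)%N.
  by apply: partdeg_gt0; rewrite Eu.
have uE := mnm_divX ui; exists (mdeg (u - U_(i))%MM).
  by rewrite -ud {1}uE mdegD mdeg1 addn1.
exists E, (u - U_(i))%MM; split=> //.
  by rewrite -Eu {2}uE partdegD partdeg1 iE addn1.
move=> D DW DE; have := Wu D DW DE.
rewrite {1}uE partdegD partdeg1 => /leq_trans-/(_ _)/(_ _) H.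
by rewrite -ltnS; apply: H; rewrite -addn1 leq_add2l leq_b1.
Qed.

(** The multiplier has one factor in E, and for each D other than E one factor in
    D outside E, which exists as W is an antichain. Its E-degree is therefore
    exactly one, its D-degree at least one, and its total degree #|W|. *)
Lemma colon_witness_succ W k d : antichain W -> finset.set0 \notin W ->
  colon_witness W k d ->
  exists2 d', (d < d' <= d + #|W|)%N & colon_witness W k.+1 d'.
Proof.
move=> antiW W0 [E [u [EW ud Eu Wu]]].
have [i iE] : exists i, i \in E.
  by apply/finset.set0Pn; apply: contraNneq W0 => <-.
have /choice[j jP] : forall D, exists j,
    D \in W -> D != E -> j \in D /\ j \notin E.
  move=> D; have [/andP[DW DE]|] := boolP ((D \in W) && (D != E)).
    by have [j] := antichainPn antiW EW DW DE; exists j.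
  by rewrite negb_and => /orP nD; exists i => DW DE; case: nD; rewrite ?DW ?DE.
pose w := (\big[mnm_add/0%MM]_(D in W :\ E) U_(j D))%MM.
have wE : partdeg E w = 0%N.
  rewrite partdeg_sum big1 // => D /setD1P[DE DW]; rewrite partdeg1.
  by have [_ /negbTE ->] := jP D DW DE.
have wdeg : mdeg w = #|W :\ E|.
  by rewrite mdeg_sum -sum1_card; apply: eq_bigr => D _; rewrite mdeg1.
exists (mdeg (u + (U_(i) + w)))%MM.
  rewrite !mdegD mdeg1 wdeg ud (cardsD1 E W) EW /=.
  by rewrite add1n addnS leqnn ltnS leq_addr.
exists E, (u + (U_(i) + w))%MM; split=> //.
  by rewrite !partdegD partdeg1 iE wE addn0 addn1 Eu.
move=> D DW DE; rewrite !partdegD -addn1 leq_add ?Wu // addnC ltn_addr //.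
rewrite partdeg_sum (bigD1 D) /=; last by rewrite in_setD1 DE.
by rewrite partdeg1; have [-> _] := jP D DW DE; rewrite ltn_addr.
Qed.

(** The monomial 1 has degree 0 in every component, so it can only miss the first
    power of a single one. *)
Lemma colon_witness0 W k : (1 <= k)%N -> colon_witness W k 0 ->
  k = 1%N /\ exists E, W = [set E]%SET.
Proof.
move=> k1 [E [u [EW /eqP u0 Eu Wu]]].
have u0E D : partdeg D u = 0%N.
  move: u0; rewrite mdeg_eq0 => /eqP ->.
  by rewrite /partdeg big1 // => i _; rewrite mnm0E.
split; first by rewrite -Eu u0E.
exists E; apply/finset.setP => D; rewrite inE; apply/idP/eqP => [DW|-> //].
by apply/eqP; apply: contraLR k1 => /(Wu D DW); rewrite u0E -leqNgt.
Qed.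

End Witnesses.

(** * v-numbers *)

Section VNumber.
Context {K : fieldType} {n : nat}.
Implicit Types (W : {set {set 'I_n}}) (I : set {mpoly K[n]}).

Lemma v_number_min I d : I <> max_ideal K n -> v_degrees I d ->
  v_degrees I (v_number I) /\ (v_number I <= d)%N.
Proof.
move=> Imax Id; rewrite /v_number asboolF //.
have exd : exists e, `[< v_degrees I e >] by exists d; apply/asboolP.
case: xgetP => [e _ [Ie mine]|no]; first by split=> //; apply: mine.
case: (ex_minnP exd) => e /asboolP Ie mine; case: (no e); split=> // e' Ie'.
by apply: mine; apply/asboolP.
Qed.

Lemma max_ideal_varpow : max_ideal K n = varpow finset.setT 1.
Proof.
apply/seteqP; split=> [|f Hf].
  apply: ideal_gen_sub => [|_ [i ->]]; first exact: varpow_ideal.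
  by apply/varpowX; rewrite partdeg1 inE.
apply: ideal_msupp => [|u /Hf /partdeg_gt0[i _ ui]]; first exact: is_ideal_gen.
rewrite (mnm_divX ui) mpolyXD.
have [_ _] := is_ideal_gen [set f : {mpoly K[n]} | exists i, f = 'X_i].
by apply; apply: sub_ideal_gen; exists i.
Qed.

Lemma interpow1 (E : {set 'I_n}) k : interpow (K := K) [set E]%SET k = varpow E k.
Proof.
apply/seteqP; split=> [f Hf|f Hf D]; first by apply: Hf; rewrite inE.
by rewrite inE => /eqP ->.
Qed.

Section Components.
Context (W : {set {set 'I_n}}).
Context (antiW : antichain W) (W0 : finset.set0 \notin W).
Context (Wn0 : W != finset.set0).

(** For the maximal ideal the monomial 1 is a witness, in agreement with its
    v-number being 0 by convention. *)
Lemma interpow_max_witness k : (1 <= k)%N ->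
  interpow W k = max_ideal K n -> colon_witness W k 0.
Proof.
move=> k1 maxW.
have kW i E : E \in W -> (k <= (i \in E))%N.
  move=> EW; have : interpow W k ('X_i : {mpoly K[n]}).
    by rewrite maxW max_ideal_varpow; apply/varpowX; rewrite partdeg1 inE.
  by move=> /(_ E EW)/varpowX; rewrite partdeg1.
have [E EW] := finset.set0Pn _ Wn0.
have ET D : D \in W -> D = finset.setT.
  move=> DW; apply/finset.setP => i; rewrite inE.
  by have := leq_trans k1 (kW i D DW); case: (i \in D).
have [i _] : exists i, i \in E.
  by apply/finset.set0Pn; apply: contraNneq W0 => <-.
have -> : k = 1%N.
  by apply/eqP; rewrite eqn_leq k1 andbT (leq_trans (kW i E EW)) ?leq_b1.
have := colon_witness1 antiW EW; suff -> : mdeg (mnmC E) = 0%N by [].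
apply/eqP; rewrite mdeg_eq0; apply/eqP/mnmP => l.
by rewrite mnmE mnm0E (ET E EW) inE.
Qed.

(** For k >= 2 witnesses of positive degree come from those for k = 1. For k = 1
    the complement of a cover E has degree 0 only if E is the set of all variables,
    and then it is the only component. *)
Lemma colon_witness_pos k : (1 <= k)%N -> interpow W k <> max_ideal K n ->
  exists2 d, (1 <= d)%N & colon_witness W k d.
Proof.
case: k => // k _; case: k => [|k] nmax; last first.
  elim: k {nmax} => [|k [d d1 Wd]]; last first.
    have [d' /andP[dd' _] Wd'] := colon_witness_succ antiW W0 Wd.
    by exists d' => //; apply: leq_ltn_trans dd'.
  have [E EW] := finset.set0Pn _ Wn0.
  have [d /andP[d1 _] Wd] :=
    colon_witness_succ antiW W0 (colon_witness1 antiW EW).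
  by exists d => //; apply: leq_ltn_trans d1.
have [E EW] := finset.set0Pn _ Wn0; have WE := colon_witness1 antiW EW.
case: (posnP (mdeg (mnmC E))) => [E0|E1]; last by exists (mdeg (mnmC E)).
case: nmax; rewrite E0 in WE; have [_ [D WD]] := colon_witness0 (ltn0Sn 0) WE.
rewrite WD interpow1 max_ideal_varpow; congr (varpow _ 1).
move: EW; rewrite WD inE => /eqP <-; apply/finset.setP => i; rewrite inE.
move/eqP: E0; rewrite mdeg_eq0 => /eqP/mnmP/(_ i); rewrite mnmE mnm0E.
by case: (i \in E).
Qed.

Lemma v_number_witness k : (1 <= k)%N ->
  colon_witness W k (v_number (interpow (K := K) W k)).
Proof.
move=> k1; have [maxW|nmax] := pselect (interpow W k = max_ideal K n).
  by rewrite /v_number asboolT //; apply: interpow_max_witness.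
have [d d1 Wd] := colon_witness_pos k1 nmax.
have Vd : v_degrees (interpow (K := K) W k) d by apply/v_degreesP.
by have [/v_degreesP[]] := v_number_min nmax Vd.
Qed.

Lemma v_number_le k d : colon_witness W k d ->
  (1 <= d)%N \/ interpow W k = max_ideal K n ->
  (v_number (interpow (K := K) W k) <= d)%N.
Proof.
move=> Wd d1; have [maxW|nmax] := pselect (interpow W k = max_ideal K n).
  by rewrite /v_number asboolT.
case: d1 => // d1.
have Vd : v_degrees (interpow (K := K) W k) d by apply/v_degreesP.
by have [] := v_number_min nmax Vd.
Qed.

End Components.
End VNumber.

(* With degrees d >= 1 in the definition of the v-number, a prime ideal I other
   than the maximal one has v(I) = v(I^(2)) = 1; the lower bound is therefore
   asserted in all cases but this one (k = 1, I prime, I <> max_ideal). *)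
Theorem theorem5p14 (K : fieldType) (n : nat) (I : set {mpoly K[n]})
    (m k : nat)
    (I_neq0 : I <> [set 0]) (I_proper : I <> setT)
    (I_sqfree : equigenerated_squarefree I)
    (I_unmixed : Ass I = Min I)
    (card_Min : (Min I #= `I_m)%card)
    (k_ge1 : (1 <= k)%N) :
  (~ [/\ k = 1%N, is_prime_ideal I & I <> max_ideal K n] ->
     (v_number (symbolic_power I k) + 1
        <= v_number (symbolic_power I k.+1))%N) /\
  (v_number (symbolic_power I k.+1)
     <= v_number (symbolic_power I k) + m)%N.
Proof.
rewrite !symbolic_interpow //.
have anti : antichain (min_covers I) by apply: antichain_min_covers.
have Iint := squarefree_min_interpow I_sqfree.
have W0 : finset.set0 \notin min_covers I.
  apply/negP => /min_coversW/vertex_coversP I0; apply: I_neq0.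
  apply/seteqP; split=> [f /I0 Hf|_ ->] /=.
    apply/eqP; rewrite -msupp_eq0; apply/eqP; case E: (msupp f) => [//|u s].
    by have := Hf u; rewrite E mem_head /partdeg big_set0 => /(_ isT).
  by rewrite Iint => E _; have [] := @varpow_ideal K n E 1.
have Wn0 : min_covers I != finset.set0.
  apply/eqP => Wempty; apply: I_proper; rewrite Iint Wempty.
  by apply/seteqP; split=> // f _ E; rewrite inE.
rewrite -(card_min_covers I_sqfree card_Min); split=> [nprime|].
  have [d' -> Wd'] := colon_witness_pred k_ge1
    (v_number_witness (K := K) anti W0 Wn0 (ltn0Sn k)).
  rewrite addn1 ltnS; apply: v_number_le => //.
  (* A witness of degree 0 for I^(k) forces k = 1 and I prime, hence maximal. *)
  case: (posnP d') => [d0|]; [right|by left].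
  rewrite d0 in Wd'; have [k1 [E WE]] := colon_witness0 k_ge1 Wd'.
  rewrite k1 -Iint; apply: contrapT => nmax; apply: nprime; split=> //.
  by rewrite Iint WE interpow1; apply: varpow_prime.
have [d /andP[d1 dm] Wd] := colon_witness_succ anti W0
  (v_number_witness (K := K) anti W0 Wn0 k_ge1).
apply: leq_trans dm; apply: v_number_le => //; left.
exact: leq_ltn_trans d1.
Qed.
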